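(* Let $(P_\alpha)_{\alpha\in A}$ be a net of probability measures on $(\mathcal{F},\mathcal{B}_F)$ and let $P$ be a probability measure on $(\mathcal{F},\mathcal{B}_F)$. Consider the condition $$(\ast)\qquad \limsup_\alpha P_\alpha\Big(\bigcap_{F \in \mathcal{F}^*} \mathcal{H}(F)\Big) \le P\Big(\bigcap_{F \in \mathcal{F}^*} \mathcal{H}(F)\Big)\quad\text{for every collection } \mathcal{F}^* \subseteq \mathcal{F} \text{ of closed sets in } E.$$ (1) If $P_\alpha \rightarrow_w P$ on $(\mathcal{F},\tau_{uF})$ and $(P_\alpha)$ is asymptotically compact-bounded, then $(\ast)$ holds. (2) If the limit $P$ is compact-bounded, then the reverse conclusion holds: $(\ast)$ implies that $P_\alpha \rightarrow_w P$ on $(\mathcal{F},\tau_{uF})$ and that $(P_\alpha)$ is asymptotically compact-bounded.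
   Context: $(E,\mathcal{G})$ is a non-empty locally compact, second-countable Hausdorff space; $\mathcal{G}$ is the family of its open sets, and $\mathcal{F}$ and $\mathcal{K}$ are the families of all closed and all compact subsets of $E$. For $B\subseteq E$ put $\mathcal{M}(B)=\{F\in\mathcal{F}: F\cap B=\emptyset\}$ and $\mathcal{H}(B)=\{F\in\mathcal{F}: F\cap B\neq\emptyset\}$. The Fell topology $\tau_F$ on $\mathcal{F}$ is generated by $\{\mathcal{M}(K):K\in\mathcal{K}\}\cup\{\mathcal{H}(G):G\in\mathcal{G}\}$; the upper Fell topology $\tau_{uF}$ on $\mathcal{F}$ is generated by $\{\mathcal{M}(K):K\in\mathcal{K}\}$. Their Borel $\sigma$-algebras coincide: $\mathcal{B}_F:=\sigma(\tau_F)=\sigma(\tau_{uF})$. The probabilities in $(\ast)$ are ordinary probabilities of the intersections $\bigcap_{F\in\mathcal{F}^*}\mathcal{H}(F)$, which the author asserts are all elements of $\mathcal{B}_F$. The net $(P_\alpha)$ is asymptotically compact-bounded if for each $\epsilon>0$ there exists a $K\in\mathcal{K}$ with $\liminf_\alpha P_\alpha(\{F\in\mathcal{F}:F\subseteq K\})\ge 1-\epsilon$. A single probability measure $P$ is compact-bounded if for each $\epsilon>0$ there exists a $K\in\mathcal{K}$ with $P(\{F\in\mathcal{F}:F\subseteq K\})\ge 1-\epsilon$. (The sets $\{F\in\mathcal{F}:F\subseteq K\}$ belong to $\mathcal{B}_F$.) Weak convergence: for a topological space $(X,\mathcal{O})$, a net $(P_\alpha)_{\alpha\in A}$ ($A$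 a directed set) of probability measures and a probability measure $P$ on $(X,\sigma(\mathcal{O}))$, $P_\alpha\rightarrow_w P$ on $(X,\mathcal{O})$ means convergence in the weak topology, i.e. the initial topology on the set of probability measures on $(X,\sigma(\mathcal{O}))$ with respect to the maps $Q\mapsto Q(O)$, $O\in\mathcal{O}$, into $\mathbb{R}$ with the topology $\{(a,\infty):a\in\mathbb{R}\}\cup\{\emptyset,\mathbb{R}\}$. Equivalently: $\liminf_\alpha P_\alpha(O)\ge P(O)$ for all $O\in\mathcal{O}$; equivalently: $\limsup_\alpha P_\alpha(C)\le P(C)$ for all closed sets $C$ of $(X,\mathcal{O})$.
   Formalization: Condition (∗) is required only for collections 𝓕* whose intersection of the sets H(F) lies in B_F; this can fail (E countable discrete, 𝓕* a nonprincipal ultrafilter), and then the probabilities in (∗) are undefined. *)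

(* Defs.v *)
From HB Require Import structures.
From mathcomp Require Import all_boot all_order all_algebra.
From mathcomp Require Import all_classical all_reals all_analysis.
Set Implicit Arguments.
Unset Strict Implicit.
Unset Printing Implicit Defensive.
Import Order.TTheory GRing.Theory Num.Theory.
Local Open Scope classical_set_scope.
Local Open Scope ring_scope.

Definition directed_set (A : Type) (le : A -> A -> Prop) : Prop :=
  [/\ inhabited A,
      forall a, le a a,
      forall a b c, le a b -> le b c -> le a c &
      forall a b, exists c, le a c /\ le b c].

Definition tails (A : Type) (le : A -> A -> Prop) : set_system A :=
  [set S | exists a, forall b, le a b -> S b].

(* [limf_esup] and [limf_einf] want a filtered domain, which a bare directed
   set does not have, so they are applied to the image filter on [\bar R];
   the values are inf_a sup_(b >= a) u b and sup_a inf_(b >= a) u b. *)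
Definition net_limsup (R : realType) (A : Type) (le : A -> A -> Prop)
    (u : A -> \bar R) : \bar R :=
  limf_esup (@id (\bar R)) (u @ tails le).

Definition net_liminf (R : realType) (A : Type) (le : A -> A -> Prop)
    (u : A -> \bar R) : \bar R :=
  limf_einf (@id (\bar R)) (u @ tails le).

Definition closed_set (E : topologicalType) := {F : set E | closed F}.

HB.instance Definition _ (E : topologicalType) :=
  gen_eqMixin (closed_set E).
HB.instance Definition _ (E : topologicalType) :=
  gen_choiceMixin (closed_set E).
HB.instance Definition _ (E : topologicalType) :=
  isPointed.Build (closed_set E) (exist _ set0 (@closed0 E)).

Definition missing (E : topologicalType) (B : set E) : set (closed_set E) :=
  [set F | sval F `&` B = set0].

Definition hitting (E : topologicalType) (B : set E) : set (closed_set E) :=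
  [set F | sval F `&` B !=set0].

Definition fell (E : topologicalType) := closed_set E.
HB.instance Definition _ (E : topologicalType) := Pointed.on (fell E).
HB.instance Definition _ (E : topologicalType) :=
  @isSubBaseTopological.Build (fell E) (set (closed_set E))
    ([set missing K | K in @compact E] `|` [set hitting G | G in @open E]) id.

Definition upper_fell (E : topologicalType) := closed_set E.
HB.instance Definition _ (E : topologicalType) := Pointed.on (upper_fell E).
HB.instance Definition _ (E : topologicalType) :=
  @isSubBaseTopological.Build (upper_fell E) (set (closed_set E))
    [set missing K | K in @compact E] id.

(* The carrier [closed_set E] with the Borel sets of the Fell topology, which
   are also the Borel sets of the upper Fell topology when [E] is locally
   compact, second-countable and Hausdorff. *)
Definition fell_borel (E : topologicalType) :=
  g_sigma_algebraType (@open (fell E)).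
HB.instance Definition _ (E : topologicalType) := Measurable.on (fell_borel E).

(* The topology on probability measures that is initial for the maps
   [Q |-> Q U], [U] in [O], into the reals with the topology of the rays
   ]a, +oo[: the sets [Q U > a] form a subbase. The family [O] is a parameter
   because different topologies may have the same Borel sets. *)
Definition weak_probability d (T : measurableType d) (R : realType)
    (O : set_system T) := probability T R.
HB.instance Definition _ d (T : measurableType d) (R : realType)
    (O : set_system T) := gen_eqMixin (weak_probability R O).
HB.instance Definition _ d (T : measurableType d) (R : realType)
    (O : set_system T) := gen_choiceMixin (weak_probability R O).
HB.instance Definition _ d (T : measurableType d) (R : realType)
    (O : set_system T) :=
  @isSubBaseTopological.Build (weak_probability R O) (set (probability T R))
    [set [set Q : probability T R | (a%:E < Q U)%E] | U in O & a in [set: R]]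
    id.

Definition weak_cvg d (T : measurableType d) (R : realType) (O : set_system T)
    (A : Type) (le : A -> A -> Prop)
    (P_ : A -> probability T R) (P : probability T R) : Prop :=
  (P_ : A -> weak_probability R O) @ tails le --> (P : weak_probability R O).

Section FellProbability.
Variables (R : realType) (E : topologicalType).

Definition upper_fell_open : set_system (fell_borel E) := @open (upper_fell E).

Definition within_set (K : set E) : set (fell_borel E) :=
  [set F | sval F `<=` K].

Definition is_compact_bounded (P : probability (fell_borel E) R) : Prop :=
  forall eps : R, 0 < eps ->
    exists2 K : set E, compact K & ((1 - eps)%:E <= P (within_set K))%E.

Definition is_asymptotically_compact_bounded (A : Type) (le : A -> A -> Prop)
    (P_ : A -> probability (fell_borel E) R) : Prop :=
  forall eps : R, 0 < eps ->
    exists2 K : set E, compact K &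
      ((1 - eps)%:E <= net_liminf le (fun a => P_ a (within_set K)))%E.

(* The inequality is asked for whenever the intersection S is an event: the
   values of a [probability] outside the sigma-algebra are unconstrained, and
   S need not be Borel (for [E] countable discrete and [Fs] a nonprincipal
   ultrafilter, S is [Fs] itself). *)
Definition limsup_hitting_le (A : Type) (le : A -> A -> Prop)
    (P_ : A -> probability (fell_borel E) R) (P : probability (fell_borel E) R)
    : Prop :=
  forall Fs : set (closed_set E),
    let S : set (fell_borel E) := \bigcap_(F in Fs) hitting (sval F) in
    measurable S ->
    (net_limsup le (fun a => P_ a S) <= P S)%E.

End FellProbability.

(* Main.v *)
Require Import Defs.
From mathcomp Require Import all_boot all_order all_algebra.
From mathcomp Require Import all_classical all_reals all_analysis.
From mathcomp Require Import lra.
Set Implicit Arguments.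
Unset Strict Implicit.
Unset Printing Implicit Defensive.
Import Order.TTheory GRing.Theory Num.Theory.
Local Open Scope classical_set_scope.
Local Open Scope ring_scope.

(** A set of closed sets is closed for the upper Fell topology exactly when it
    is an intersection of sets [hitting K] with [K] compact (see
    [upper_fell_openE] for the complements); hence weak convergence says that
    the limsup inequality holds for these intersections ([weak_cvg_limsupP]).

    From weak convergence to arbitrary closed sets: on the event that the random
    set lies in a compact [K], hitting [F] is the same as hitting [F `&` K],
    which is compact.  Thus [\bigcap_F hitting F] differs from an
    upper-Fell-closed subset of it only outside [within_set K], an event whose
    probability is eventually at most epsilon by asymptotic
    compact-boundedness.

    Conversely, compact sets are closed because [E] is Hausdorff, so the limsup
    inequality for closed sets contains the one for compact sets and gives weak
    convergence.  For asymptotic compact-boundedness, if [P] charges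
    [within_set K] with mass at least [1 - eps], local compactness provides a
    compact [L] whose interior contains [K] ([compact_sub_interior]).  The
    limsup inequality for the single closed set [~` L°] bounds the mass left
    outside [within_set L].  The event [hitting (~` L°)] is measurable because a
    closed subset of [E] is sigma-compact ([measurable_hitting_closed]). *)

(** * Limits along a directed set *)

Lemma tails_filter (A : Type) (le : A -> A -> Prop) :
  directed_set le -> Filter (tails le).
Proof.
move=> [[a0] lexx le_trans le_dir]; split.
- by exists a0.
- move=> S T [a aS] [b bT]; have [c [ac bc]] := le_dir a b.
  by exists c => d cd; split; [apply: aS|apply: bT]; exact: le_trans cd.
- by move=> S T ST [a aS]; exists a => b /aS /ST.
Qed.

Lemma net_limsup_leP (R : realType) (A : Type) (le : A -> A -> Prop)
    (u : A -> \bar R) (r : R) : directed_set le ->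
  (net_limsup le u <= r%:E)%E <->
  forall e : R, 0 < e -> tails le [set a | (u a < (r + e)%:E)%E].
Proof.
move=> le_dir; have FF := tails_filter le_dir.
rewrite /net_limsup limf_esupE; split=> [ur e e0|ur].
  have /ereal_inf_lt[_ [V FV <-] supV] :
      (ereal_inf [set ereal_sup (id @` V) | V in u @ tails le] <
       (r + e)%:E)%E by apply: (le_lt_trans ur); rewrite lte_fin ltrDl.
  apply: (@filterS _ (tails le) FF (u @^-1` V)) => // a Va.
  apply: le_lt_trans supV.
  by apply: ereal_sup_ubound; exists (u a).
apply/lee_addgt0Pr => e e0; apply: ge_ereal_inf.
exists (ereal_sup (id @` [set x : \bar R | (x < (r + e)%:E)%E])).
  by exists [set x : \bar R | (x < (r + e)%:E)%E] => //; exact: ur.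
by apply/ereal_supP => _ [x /= xr <-]; rewrite -EFinD ltW.
Qed.

Lemma net_liminf_geP (R : realType) (A : Type) (le : A -> A -> Prop)
    (u : A -> \bar R) (r : R) : directed_set le ->
  (r%:E <= net_liminf le u)%E <->
  forall e : R, 0 < e -> tails le [set a | ((r - e)%:E < u a)%E].
Proof.
move=> le_dir; have FF := tails_filter le_dir.
rewrite /net_liminf limf_einfE; split=> [ur e e0|ur].
  have /ereal_sup_gt[_ [V FV <-] infV] :
      ((r - e)%:E <
       ereal_sup [set ereal_inf (id @` V) | V in u @ tails le])%E.
    by apply: lt_le_trans ur; rewrite lte_fin ltrBlDr ltrDl.
  apply: (@filterS _ (tails le) FF (u @^-1` V)) => // a Va.
  apply: (lt_le_trans infV).
  by apply: ereal_inf_lbound; exists (u a).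
apply/lee_addgt0Pr => e e0; rewrite -leeBlDr// -EFinB; apply: le_ereal_sup_tmp.
exists (ereal_inf (id @` [set x : \bar R | ((r - e)%:E < x)%E])).
  by exists [set x : \bar R | ((r - e)%:E < x)%E] => //; exact: ur.
by apply/ereal_infP => _ [x /= xr <-]; rewrite ltW.
Qed.

(** * Weak convergence *)

(** Portmanteau: weak convergence in terms of the open sets, that is,
    [liminf P_a U >= P U] with the liminf spelled out along tails. *)
Lemma weak_cvgP d (T : measurableType d) (R : realType) (O : set_system T)
    (A : Type) (le : A -> A -> Prop) (P_ : A -> probability T R)
    (P : probability T R) : directed_set le ->
  weak_cvg O le P_ P <->
  forall U, O U -> forall r : R, (r%:E < P U)%E ->
    tails le [set a | (r%:E < P_ a U)%E].
Proof.
move=> le_dir; have FF := tails_filter le_dir; split=> [cvP U OU r rU|cvP].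
  apply: (cvP [set Q : weak_probability R O | (r%:E < Q U)%E]).
  apply: open_nbhs_nbhs; split=> //.
  exists [set [set Q : weak_probability R O | (r%:E < Q U)%E]].
    by move=> _ ->; apply: finI_from1; exists U => //; exists r.
  by rewrite bigcup_set1.
move=> W; rewrite /= nbhsE => -[B [[D' D'sub BE] BP] BW].
apply: filterS (BW) _; move: BP; rewrite -BE => -[V D'V VP].
have [X Xsub VE] := D'sub _ D'V.
apply: (@filterS _ _ _ V); first by move=> Q VQ; exists V.
rewrite -VE; apply: filter_bigI => S XS.
have /set_mem[U OU [r _ SE]] := Xsub _ XS.
move: VP; rewrite -VE => /(_ _ XS); rewrite /= -SE /= => rU.
exact: cvP.
Qed.

Lemma probability_EFin d (T : measurableType d) (R : realType)
    (Q : probability T R) (U : set T) :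
  measurable U -> exists r : R, Q U = r%:E.
Proof. by move=> mU; exists (fine (Q U)); rewrite fineK ?fin_num_measure. Qed.

(** Portmanteau: weak convergence in terms of the closed sets [~` U]. *)
Lemma weak_cvg_limsupP d (T : measurableType d) (R : realType)
    (O : set_system T) (A : Type) (le : A -> A -> Prop)
    (P_ : A -> probability T R) (P : probability T R) :
  directed_set le -> O `<=` measurable ->
  weak_cvg O le P_ P <->
  forall U, O U -> (net_limsup le (fun a => P_ a (~` U)) <= P (~` U))%E.
Proof.
move=> le_dir mO; have FF := tails_filter le_dir.
rewrite (weak_cvgP O P_ P le_dir); split=> cvP U OU; have mU := mO _ OU;
  have [p pE] := probability_EFin P mU.
  rewrite probability_setC// pE -EFinB.
  apply/(net_limsup_leP _ _ le_dir) => e e0.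
  apply: filterS (cvP U OU (p - e) _); last by rewrite pE lte_fin ltrBlDr ltrDl.
  move=> a /=; have [q qE] := probability_EFin (P_ a) mU.
  rewrite probability_setC// qE -EFinB !lte_fin; lra.
move=> r; rewrite pE lte_fin => rp.
have := cvP U OU; rewrite probability_setC// pE -EFinB.
move=> /(net_limsup_leP _ _ le_dir)/(_ (p - r)).
rewrite subr_gt0 => /(_ rp); apply: filterS => a /=.
have [q qE] := probability_EFin (P_ a) mU.
rewrite probability_setC// qE -EFinB !lte_fin; lra.
Qed.

(** * Compact sets in locally compact spaces *)

Section LocallyCompact.
Context {E : topologicalType}.
Hypothesis E_lcpt : locally_compact [set: E].

(** Otherwise the sets [K `\` L°], [L] compact, generate a proper filter on [K];
    it has a cluster point in [K], none of whose neighbourhoods is compact. *)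
Lemma compact_sub_interior (K : set E) : compact K ->
  exists2 L : set E, compact L & K `<=` L°.
Proof.
move=> cK; apply: contrapT => noL.
pose F := filter_from (@compact E) (fun L => K `\` L°).
have FF : ProperFilter F.
  apply: filter_from_proper => [|L cL].
    apply: filter_from_filter; first by exists set0; exact: compact0.
    move=> L M cL cM; exists (L `|` M); first exact: compactU.
    move=> x [Kx LMx]; split; split=> // ix; apply: LMx.
      by apply: filterS ix => ?; left.
    by apply: filterS ix => ?; right.
  apply: contrapT => KL0; apply: noL; exists L => // x Kx.
  by apply: contrapT => nLx; apply: KL0; exists x.
have FK : F K by exists set0; [exact: compact0|move=> x []].
have [x [Kx Fx]] := cK F FF FK.
have [L] := @E_lcpt x Logic.I; rewrite withinET => Lx [cL _].
have FL : F (K `\` L°) by exists L.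
by have [y [[_ nLy]]] := Fx _ _ FL (nbhs_interior Lx).
Qed.

Lemma sigma_compact : @second_countable E ->
  exists2 C : nat -> set E, (forall n, compact (C n)) &
    \bigcup_n C n = [set: E].
Proof.
move=> [B /countable_injP[f f_inj] [_ Bnbhs]].
(* The n-th set is the closure of the member of the base numbered n, when that
   closure is compact, and the empty set otherwise. *)
pose S n := [set C : set E | exists V, [/\ B V, f V = n, compact (closure V) &
  C = closure V]].
exists (fun n => xget set0 (S n)) => [n|].
  by case: xgetP => [_ _ [V [_ _ cV ->]]//|_]; exact: compact0.
apply/seteqP; split=> // x _.
have [U] := @E_lcpt x Logic.I; rewrite withinET => Ux [cU clU].
have [V [BV Vx] VU] := Bnbhs _ _ Ux.
have cV : compact (closure V).
  by rewrite -precompactE; exists U.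
have [W [BW WV _ WE]] : S (f V) (xget set0 (S (f V))).
  by apply: xgetPex; exists (closure V), V.
exists (f V) => //; rewrite WE (f_inj W V) ?inE//; exact: subset_closure.
Qed.

End LocallyCompact.

(** * The Fell topologies *)

Section Fell.
Context {E : topologicalType}.
Implicit Types (B K F : set E).

Lemma hittingC B : ~` hitting B = missing B.
Proof. by apply/seteqP; split=> F /= /nonemptyPn. Qed.

Lemma missingU B C : missing (B `|` C) = missing B `&` missing C.
Proof.
by rewrite predeqE => F; rewrite /missing/= setIUr setU_eq0.
Qed.

(** Finite intersections of sets [missing K] are again of that form, so that
    these sets are not only a subbase but a base of the upper Fell topology. *)
Lemma upper_fell_openE (U : set (upper_fell E)) : open U ->
  exists2 D : set (set E), D `<=` compact & U = \bigcup_(K in D) missing K.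
Proof.
move=> [D' D'sub <-].
exists [set K | compact K /\ missing K `<=` \bigcup_(V in D') V].
  by move=> K [].
apply/seteqP; split=> [F [V D'V VF]|F [K [_ KD'] KF]]; last exact: KD'.
suff [K cK KV] : exists2 K, compact K & missing K = V.
  by exists K; [split=> //; rewrite KV => G VG; exists V|rewrite KV].
have [X Xsub <-] := D'sub _ D'V; rewrite bigcap_fset big_seq.
elim/big_ind : _ => [|_ _ [K cK <-] [L cL <-]|V' /Xsub/set_mem[K cK <-]].
- exists set0; first exact: compact0.
  by apply/seteqP; split=> // G _; rewrite /missing/= setI0.
- by exists (K `|` L); [exact: compactU|exact: missingU].
- by exists K.
Qed.

Lemma measurable_missing K : compact K ->
  measurable (missing K : set (fell_borel E)).
Proof.
move=> cK; apply: sub_sigma_algebra; exists [set missing K].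
  by move=> _ ->; apply: finI_from1; left; exists K.
by rewrite bigcup_set1.
Qed.

Lemma measurable_hitting_open B : open B ->
  measurable (hitting B : set (fell_borel E)).
Proof.
move=> oB; apply: sub_sigma_algebra; exists [set hitting B].
  by move=> _ ->; apply: finI_from1; right; exists B.
by rewrite bigcup_set1.
Qed.

Lemma measurable_hitting_compact K : compact K ->
  measurable (hitting K : set (fell_borel E)).
Proof.
move=> cK; rewrite -[X in measurable X]setCK hittingC.
by apply: measurableC; exact: measurable_missing.
Qed.

Lemma upper_fell_open_measurable : @upper_fell_open E `<=` measurable.
Proof.
move=> U /upper_fell_openE[D Dsub ->]; apply: sub_sigma_algebra.
exists [set missing K | K in D]; last by rewrite bigcup_image.
by move=> _ [K DK <-]; apply: finI_from1; left; exists K => //; exact: Dsub.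
Qed.

Lemma within_setE K : within_set K = ~` hitting (~` K).
Proof.
by rewrite hittingC predeqE => F; rewrite /missing/= disjoints_subset setCK.
Qed.

Lemma measurable_within_set K : closed K -> measurable (within_set K).
Proof.
move=> clK; rewrite within_setE; apply: measurableC.
by apply: measurable_hitting_open; exact: closed_openC.
Qed.

(** A closed set is a countable union of compact sets, and [hitting] commutes
    with unions. *)
Lemma measurable_hitting_closed F :
  locally_compact [set: E] -> @second_countable E -> closed F ->
  measurable (hitting F : set (fell_borel E)).
Proof.
move=> E_lcpt E_2nd clF; have [C cC CT] := sigma_compact E_lcpt E_2nd.
have -> : hitting F = \bigcup_n hitting (C n `&` F).
  apply/seteqP; split=> G; last by case=> n _ [x [Gx [_ Fx]]]; exists x.
  move=> [x [Gx Fx]]; have [n _ Cx] : (\bigcup_n C n) x by rewrite CT.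
  by exists n => //; exists x.
apply: bigcupT_measurable => n; apply: measurable_hitting_compact.
exact: compact_closedI.
Qed.

(** The set [\bigcap_(F in Fs) hitting (F `&` K)] is closed for the upper Fell
    topology, which is not true of [\bigcap_(F in Fs) hitting F] in general. *)
Lemma upper_fell_open_setC_hittingI (Fs : set (closed_set E)) K : compact K ->
  @upper_fell_open E (~` \bigcap_(F in Fs) hitting (sval F `&` K)).
Proof.
move=> cK; rewrite setC_bigcap; apply: bigcup_open => F _; rewrite hittingC.
exists [set missing (sval F `&` K)]; last by rewrite bigcup_set1.
move=> _ ->; apply: finI_from1; exists (sval F `&` K) => //.
by rewrite setIC; apply: compact_closedI => //; exact: svalP F.
Qed.

(** In a Hausdorff space compact sets are closed, so the closed sets of the
    upper Fell topology are intersections of sets [hitting F]. *)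
Lemma upper_fell_open_setC (U : set (upper_fell E)) : hausdorff_space E ->
  open U ->
  exists Fs : set (closed_set E), ~` U = \bigcap_(F in Fs) hitting (sval F).
Proof.
move=> E_h /upper_fell_openE[D Dsub ->].
exists [set F | D (sval F)]; rewrite setC_bigcup.
apply/seteqP; split=> [G DG F /= DF|G FG K DK].
  apply: contrapT => nFG; apply: (DG _ DF).
  by rewrite -hittingC.
have clK := compact_closed E_h (Dsub _ DK).
by rewrite -hittingC setCK; exact: (FG (exist _ K clK)).
Qed.

End Fell.

(** * Weak convergence and the limsup inequality for closed sets *)

Theorem corollary1 (R : realType) (E : topologicalType)
    (E_nonempty : [set: E] !=set0)
    (E_locally_compact : locally_compact [set: E])
    (E_second_countable : @second_countable E)
    (E_hausdorff : hausdorff_space E)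
    (A : Type) (le : A -> A -> Prop) (A_directed : directed_set le)
    (P_ : A -> probability (fell_borel E) R)
    (P : probability (fell_borel E) R) :
  (weak_cvg (@upper_fell_open E) le P_ P ->
   is_asymptotically_compact_bounded le P_ ->
   limsup_hitting_le le P_ P)
  /\
  (is_compact_bounded P ->
   limsup_hitting_le le P_ P ->
   weak_cvg (@upper_fell_open E) le P_ P /\
   is_asymptotically_compact_bounded le P_).
Proof.
have mW (K : set E) : compact K -> measurable (within_set K).
  by move=> cK; apply: measurable_within_set; exact: compact_closed.
have FF := tails_filter A_directed.
have weakP := weak_cvg_limsupP P_ P A_directed (@upper_fell_open_measurable E).
split=> [/weakP cvP bP Fs S mS|bP cvP].
  have [p pE] := probability_EFin P mS; rewrite pE.
  apply/(net_limsup_leP _ _ A_directed) => e e0.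
  have e20 : 0 < e / 2 / 2 by lra.
  (* The bound at e / 4 and a slack of e / 4 put the mass of [within_set K]
     eventually above 1 - e / 2; the other half of e is for [SK]. *)
  have [K cK /(net_liminf_geP _ _ A_directed)/(_ _ e20) tK] := bP _ e20.
  have := upper_fell_open_setC_hittingI Fs cK.
  set SK : set (fell_borel E) := \bigcap_(F in _) _ => oSK.
  have mSK : measurable SK.
    rewrite -[SK]setCK; apply: measurableC.
    exact: upper_fell_open_measurable.
  have SKS : SK `<=` S.
    by move=> G SKG F FsF; have [x [Gx [Fx _]]] := SKG _ FsF; exists x.
  (* A set that is contained in K and hits F hits F `&` K. *)
  have SKW : S `<=` SK `|` ~` within_set K.
    move=> G SG; apply: contrapT => /not_orP[nSK /contrapT GK].
    apply: nSK => F FsF; have [x [Gx Fx]] := SG _ FsF.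
    by exists x; split=> //; split=> //; exact: GK.
  have := cvP _ oSK; rewrite setCK.
  have [q qE] := probability_EFin P mSK; rewrite qE.
  have e21 : 0 < e / 2 by lra.
  move=> /(net_limsup_leP _ _ A_directed)/(_ _ e21) tSK.
  apply: filterS (filterI tK tSK) => a [/=].
  have PS : (P SK <= P S)%E by apply: le_measure; rewrite ?inE.
  have PaS : (P_ a S <= P_ a SK + P_ a (~` within_set K))%E.
    apply: le_trans (measureU2 _ mSK (measurableC (mW _ cK))).
    apply: le_measure; rewrite ?inE//; apply: measurableU => //.
    by apply: measurableC; exact: mW.
  move: PS PaS; rewrite probability_setC; last exact: mW.
  have [pa paE] := probability_EFin (P_ a) mS.
  have [qa qaE] := probability_EFin (P_ a) mSK.
  have [wa waE] := probability_EFin (P_ a) (mW _ cK).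
  rewrite pE qE paE qaE waE.
  rewrite -EFinB -EFinD !lte_fin !lee_fin; lra.
split.
  apply/weakP => U oU; have [Fs UE] := upper_fell_open_setC E_hausdorff oU.
  rewrite UE; apply: cvP; rewrite -UE; apply: measurableC.
  exact: upper_fell_open_measurable.
move=> e e0; have [K cK PK] := bP _ e0.
have [L cL KL] := compact_sub_interior E_locally_compact cK.
exists L => //; apply/(net_liminf_geP _ _ A_directed) => e' e'0.
have clF : closed (~` L°) by apply: open_closedC; exact: open_interior.
have mH := measurable_hitting_closed E_locally_compact E_second_countable clF.
have := cvP [set exist _ _ clF]; rewrite bigcap_set1 => /(_ mH).
have [h hE] := probability_EFin P mH; rewrite hE.
move=> /(net_limsup_leP _ _ A_directed)/(_ _ e'0).
have PH : (P (hitting (~` L°)) <= P (~` within_set K))%E.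
  apply: le_measure; rewrite ?inE//; first by apply: measurableC; exact: mW.
  by move=> G [x [Gx nLx]] GK; apply: nLx; exact/KL/GK.
move: PK PH; rewrite probability_setC; last exact: mW.
have [w wE] := probability_EFin P (mW _ cK); rewrite hE wE => PK PH.
apply: filterS => a /=.
have PaL : (P_ a (~` hitting (~` L°)) <= P_ a (within_set L))%E.
  apply: le_measure; rewrite ?inE//; [exact: measurableC|exact: mW|].
  move=> G nG x Gx; apply: interior_subset; apply: contrapT => nLx.
  by apply: nG; exists x.
move: PK PH PaL; rewrite probability_setC//.
have [ha haE] := probability_EFin (P_ a) mH.
have [la laE] := probability_EFin (P_ a) (mW _ cL).
rewrite haE laE -!EFinB !lte_fin !lee_fin; lra.
Qed.
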